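(* The complex hyperbolic plane $\mathbf{H}^2_{\mathbb{C}}$ endowed with the Bergman metric and the Kähler cone $(\mathcal{C}(\mathfrak{H}),\mathbb{J},g_r,\Omega_r)$ are PCR-Kähler equivalent, with respect to the subbundle $\mathcal{H}=\langle X,Y\rangle$ on $\mathcal{C}(\mathfrak{H})$ and the subbundle $\mathcal{H}'$ of $T^{(1,0)}(\mathbf{H}^2_{\mathbb{C}})$ spanned by $-\overline{z_2}\frac{\partial}{\partial z_1}+\frac{\partial}{\partial z_2}$.
   Context: $\mathfrak{H}=\mathbb{C}\times\mathbb{R}$ is the Heisenberg group with coordinates $(z=x+iy,t)$ and multiplication $(z,t)*(w,s)=(z+w,t+s+2\Im(z\overline w))$. Put $X=\partial_x+2y\,\partial_t$, $Y=\partial_y-2x\,\partial_t$, $T=\partial_t$, $\omega=dt+2x\,dy-2y\,dx$, $\widetilde T=2T$, $\widetilde\omega=\tfrac12\omega$, $g=dx^2+dy^2+\tfrac14\omega^2$. The Kähler cone is $\mathcal{C}(\mathfrak{H})=\mathfrak{H}\times\mathbb{R}_{>0}$, with coordinates $(z,t,r)$, metric $g_r=dr^2+r^2g$, complex structure $\mathbb{J}X=Y$, $\mathbb{J}Y=-X$, $\mathbb{J}(r\partial_r)=\widetilde T$, $\mathbb{J}\widetilde T=-r\partial_r$, and fundamental form $\Omega_r=d\left(\tfrac{r^2}{2}\widetilde\omega\right)$. The bundle $\mathcal{H}$ spanned by $X,Y$ is regarded as the subbundle of $T^{(1,0)}(\mathcal{C}(\mathfrak{H}))$ spanned by $Z=\tfrac12(X-iY)$.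 The complex hyperbolic plane $\mathbf{H}^2_{\mathbb{C}}$ is the Siegel domain $\mathcal{S}=\{(z_1,z_2)\in\mathbb{C}^2:\rho(z_1,z_2)>0\}$, $\rho(z_1,z_2)=-2\Re(z_1)-|z_2|^2$, with the standard complex structure and the Bergman metric $ds^2=\frac{4}{\rho}|dz_2|^2+\frac{4}{\rho^2}|dz_1+\overline{z_2}\,dz_2|^2$. PCR-Kähler equivalence: let $N$, $N'$ be Kähler manifolds of the same dimension with metrics $g_N,g_{N'}$, and let $\mathcal{H}_N\subset T^{(1,0)}(N)$, $\mathcal{H}_{N'}\subset T^{(1,0)}(N')$ be subbundles. The manifolds are PCR-Kähler equivalent (with respect to these subbundles) if there is a diffeomorphism $G:N\to N'$ such that (i) $G_*(\mathcal{H}_N)=\mathcal{H}_{N'}$, and (ii) $G^*\left(g_{N'}|_{\mathcal{H}_{N'}\times\mathcal{H}_{N'}}\right)=g_N|_{\mathcal{H}_N\times\mathcal{H}_N}$, that is, $g_{N'}(G_*U,G_*V)=g_N(U,V)$ for all $U,V$ in the underlying real subbundle of $\mathcal{H}_N$. *)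

(* Defs.v *)
From HB Require Import structures.
From mathcomp Require Import all_boot all_order all_algebra.
From mathcomp Require Import complex.
From mathcomp Require Import all_classical all_reals all_analysis.

Set Implicit Arguments.
Unset Strict Implicit.
Unset Printing Implicit Defensive.

Import Order.TTheory GRing.Theory Num.Theory.
Import numFieldNormedType.Exports.

Local Open Scope classical_set_scope.
Local Open Scope ring_scope.
Local Open Scope complex_scope.

Section Smooth.
Context {R : realType}.

Fixpoint Ck_on {V W : normedModType R} (k : nat) (U : set V) (f : V -> W) :
    Prop :=
  if k is k'.+1 then
    (forall p, U p -> differentiable f p) /\
    (forall v : V, Ck_on k' U ('D_v f))
  else forall p, U p -> {for p, continuous f}.

(* Only used for open [U]: the iterated derivatives of [f] at a point of [U]
   then depend only on the values of [f] on [U]. *)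
Definition smooth_on {V W : normedModType R} (U : set V) (f : V -> W) : Prop :=
  forall k : nat, Ck_on k U f.

Definition diffeomorphism {V W : normedModType R} (U : set V) (U' : set W)
    (G : V -> W) : Prop :=
  smooth_on U G /\ (forall p, U p -> U' (G p)) /\
  exists F : W -> V,
    [/\ smooth_on U' F, (forall q, U' q -> U (F q)),
        (forall p, U p -> F (G p) = p) & (forall q, U' q -> G (F q) = q)].

End Smooth.

(* Manifolds covered by a single chart: the manifold is an open subset of R^n,
   every tangent space is R^n, and tensor fields are given in coordinates. *)
Section Tensors.
Context {R : realType} {n : nat}.
Local Notation E := 'rV[R]_n.

Definition lie_bracket (U V : E -> E) (p : E) : E :=
  'D_(U p) V p - 'D_(V p) U p.

(* The Nijenhuis tensor, evaluated on constant (i.e. coordinate) fields, which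
   determine it since it is tensorial. *)
Definition nijenhuis (J : E -> E -> E) (p u v : E) : E :=
  lie_bracket (J ^~ u) (J ^~ v) p
  - J p (lie_bracket (J ^~ u) (cst v) p)
  - J p (lie_bracket (cst u) (J ^~ v) p)
  - lie_bracket (cst u) (cst v) p.

(* Normalised without the factors 1/2 and 1/3, so that
   d(x dy) = dx /\ dy with (dx /\ dy)(u, v) = dx(u) dy(v) - dx(v) dy(u). *)
Definition ext_d1 (a : E -> E -> R) (p u v : E) : R :=
  'D_u (a ^~ v) p - 'D_v (a ^~ u) p.

Definition ext_d2 (b : E -> E -> E -> R) (p u v w : E) : R :=
  'D_u (fun q => b q v w) p - 'D_v (fun q => b q u w) p
  + 'D_w (fun q => b q u v) p.

End Tensors.

Record kahler_data (R : realType) (n : nat) := KahlerData {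
  carrier : set 'rV[R]_n;
  cplx : 'rV[R]_n -> 'rV[R]_n -> 'rV[R]_n;
  metric : 'rV[R]_n -> 'rV[R]_n -> 'rV[R]_n -> R;
  fund_form : 'rV[R]_n -> 'rV[R]_n -> 'rV[R]_n -> R
}.

Section Kahler.
Context {R : realType} {n : nat}.
Local Notation E := 'rV[R]_n.
Local Notation EC := 'rV[R[i]]_n.
Implicit Types N : kahler_data R n.

Definition complex_structure (U : set E) (J : E -> E -> E) : Prop :=
  [/\ (forall v : E, smooth_on U (J ^~ v)),
      (forall p, U p -> linear (J p)),
      (forall p v, U p -> J p (J p v) = - v)
    & (forall p u v, U p -> nijenhuis J p u v = 0)].

Definition riemannian_metric (U : set E) (g : E -> E -> E -> R) : Prop :=
  [/\ (forall u v : E, smooth_on U (fun p => g p u v)),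
      (forall p u, U p -> scalar (g p u)),
      (forall p u v, U p -> g p u v = g p v u)
    & (forall p v, U p -> v != 0 -> 0 < g p v v)].

Definition is_kahler N : Prop :=
  [/\ open (carrier N),
      complex_structure (carrier N) (cplx N),
      riemannian_metric (carrier N) (metric N),
      (forall p u v, carrier N p ->
         metric N p (cplx N p u) (cplx N p v) = metric N p u v)
    & (forall p u v, carrier N p ->
         fund_form N p u v = metric N p (cplx N p u) v) /\
      (forall p u v w, carrier N p -> ext_d2 (fund_form N) p u v w = 0)].

Definition to_cplx (v : E) : EC := map_mx (real_complex R) v.
Definition re_part (w : EC) : E := map_mx (@complex.Re R) w.
Definition im_part (w : EC) : E := map_mx (@complex.Im R) w.

(* The complex-linear extension of a real-linear map. *)
Definition cplx_ext (f : E -> E) (w : EC) : EC :=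
  to_cplx (f (re_part w)) + 'i *: to_cplx (f (im_part w)).

Definition T10 N (p : E) : set EC :=
  [set w | cplx_ext (cplx N p) w = 'i *: w].

Definition T10_subbundle N (H : E -> set EC) : Prop :=
  (forall p, carrier N p -> H p `<=` T10 N p) /\
  exists k : nat, forall p, carrier N p ->
    exists (W : set E) (F : E -> 'M[R[i]]_(k, n)),
      [/\ open W, W p, W `<=` carrier N,
          (forall i j, smooth_on W (fun q => complex.Re (F q i j)) /\
                       smooth_on W (fun q => complex.Im (F q i j)))
        & (forall q, W q -> row_free (F q) /\
                            H q = [set w | (w <= F q)%MS])].

Definition real_subbundle (H : E -> set EC) (p : E) : set E :=
  re_part @` H p.

Definition PCR_kahler_equivalent (N N' : kahler_data R n)
    (H H' : E -> set EC) : Prop :=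
  [/\ is_kahler N, is_kahler N', T10_subbundle N H, T10_subbundle N' H'
    & exists G : E -> E,
      [/\ diffeomorphism (carrier N) (carrier N') G,
          (forall p, carrier N p -> cplx_ext ('d G p) @` H p = H' (G p))
        & (forall p u v, carrier N p ->
             real_subbundle H p u -> real_subbundle H p v ->
             metric N' (G p) ('d G p u) ('d G p v) = metric N p u v)]].

End Kahler.

Section Coordinates.
Context {K : nzRingType}.

Definition crd0 (v : 'rV[K]_4) : K := v ord0 (@Ordinal 4 0 isT).
Definition crd1 (v : 'rV[K]_4) : K := v ord0 (@Ordinal 4 1 isT).
Definition crd2 (v : 'rV[K]_4) : K := v ord0 (@Ordinal 4 2 isT).
Definition crd3 (v : 'rV[K]_4) : K := v ord0 (@Ordinal 4 3 isT).

Definition vec4 (a b c d : K) : 'rV[K]_4 := \row_(j < 4) [:: a; b; c; d]`_j.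

End Coordinates.

(* Coordinates on the cone are (x, y, t, r); as these are global linear
   coordinates on R^4, the differentials dx, dy, dt, dr of a tangent vector [v]
   are its coordinates. *)
Section HeisenbergCone.
Context {R : realType}.
Local Notation E := 'rV[R]_4.
Implicit Types p u v : E.

Local Notation x := crd0.
Local Notation y := crd1.
Local Notation r := crd3.
Local Notation dx := crd0.
Local Notation dy := crd1.
Local Notation dt := crd2.
Local Notation dr := crd3.

Definition heis_X p : E := vec4 1 0 (2 * y p) 0.
Definition heis_Y p : E := vec4 0 1 (- (2 * x p)) 0.
Definition heis_Ttilde : E := vec4 0 0 2 0.
Definition cone_rdr p : E := vec4 0 0 0 (r p).

Definition heis_omega p v : R := dt v + 2 * x p * dy v - 2 * y p * dx v.
Definition heis_omegatilde p v : R := 2^-1 * heis_omega p v.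

Definition heis_metric p u v : R :=
  dx u * dx v + dy u * dy v + 4^-1 * (heis_omega p u * heis_omega p v).

Definition cone_metric p u v : R :=
  dr u * dr v + r p ^+ 2 * heis_metric p u v.

(* X |-> Y, Y |-> -X, r d/dr |-> Ttilde, Ttilde |-> - r d/dr; the coframe dual
   to X, Y, Ttilde, r d/dr is dx, dy, omegatilde, dr / r. *)
Definition cone_J p v : E :=
  dx v *: heis_Y p - dy v *: heis_X p
  + (dr v / r p) *: heis_Ttilde - heis_omegatilde p v *: cone_rdr p.

Definition cone_form : E -> E -> E -> R :=
  ext_d1 (fun p v => r p ^+ 2 / 2 * heis_omegatilde p v).

Definition heis_cone : kahler_data R 4 :=
  KahlerData [set p | 0 < r p] cone_J cone_metric cone_form.

Definition cone_Z p : 'rV[R[i]]_4 :=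
  2^-1 *: (to_cplx (heis_X p) - 'i *: to_cplx (heis_Y p)).

Definition cone_subbundle p : set 'rV[R[i]]_4 :=
  [set c *: cone_Z p | c in [set: R[i]]].

End HeisenbergCone.

(* C^2 is identified with R^4 by (Re z1, Im z1, Re z2, Im z2); z1 and z2 being
   linear, dz1 and dz2 of a tangent vector [v] are [z1 v] and [z2 v]. *)
Section Siegel.
Context {R : realType}.
Local Notation E := 'rV[R]_4.
Implicit Types p u v : E.

Definition z1 p : R[i] := crd0 p +i* crd1 p.
Definition z2 p : R[i] := crd2 p +i* crd3 p.
Local Notation dz1 := z1.
Local Notation dz2 := z2.

Definition of_C2 (a b : R[i]) : E :=
  vec4 (complex.Re a) (complex.Im a) (complex.Re b) (complex.Im b).

Definition siegel_rho p : R :=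
  - (2 * complex.Re (z1 p)) - ComplexField.Normc.normc (z2 p) ^+ 2.

(* The real bilinear form with quadratic form |a|^2. *)
Definition polar_normc (a b : R[i]) : R := complex.Re (a * b^*).

Definition bergman_metric p u v : R :=
  4 / siegel_rho p * polar_normc (dz2 u) (dz2 v)
  + 4 / siegel_rho p ^+ 2 *
      polar_normc (dz1 u + (z2 p)^* * dz2 u) (dz1 v + (z2 p)^* * dz2 v).

Definition siegel_J p v : E := of_C2 ('i * z1 v) ('i * z2 v).

Definition siegel_domain : kahler_data R 4 :=
  KahlerData [set p | 0 < siegel_rho p] siegel_J bergman_metric
    (fun p u v => bergman_metric p (siegel_J p u) v).

(* d/dz = 1/2 (d/dx - i d/dy) *)
Definition ddz1 : 'rV[R[i]]_4 := vec4 2^-1 (- ('i / 2)) 0 0.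
Definition ddz2 : 'rV[R[i]]_4 := vec4 0 0 2^-1 (- ('i / 2)).

Definition siegel_subbundle p : set 'rV[R[i]]_4 :=
  [set c *: (- (z2 p)^* *: ddz1 + ddz2) | c in [set: R[i]]].

End Siegel.

(* Main.v *)
Require Import Defs.
From mathcomp Require Import all_boot all_order all_algebra.
From mathcomp Require Import all_classical all_reals all_analysis.
From mathcomp Require Import complex ring.

(** The equivalence is the explicit map [to_cone]
      G(z1, z2) = (z, t, r) = (z2, 2 Im z1, 2 / sqrt rho),
    under which the level sets of rho, the horospheres centred at infinity,
    become the slices r = const of the cone.

    The form theta = dz1 + conj(z2) dz2 vanishes on the horizontal bundle of the
    Siegel domain. Its real part is - d rho / 2, and G^* omega = 2 Im theta, because
    omega = dt + 2 (x dy - y dx) and t = 2 Im z1. Hence G carries the kernel of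
    theta to the common kernel of omega and dr, that is, to the span of X and Y.
    On these kernels the two metrics are (4 / rho) |dz2|^2 and r^2 |dz|^2, so
    r = 2 / sqrt rho is what makes them agree. Since moreover z = z2, the vector
    - conj(z2) d/dz1 + d/dz2 goes to Z itself. The inverse [of_cone] is obtained by
    solving rho = 4 / r^2 for Re z1 ([to_cone_diffeo]).

    Both horizontal bundles are complex lines spanned by u - i v for a real frame
    (u, v) with J u = v. The section on such lines reduces the statements about
    complexified tangent vectors to statements about (u, v): that the line is of
    type (1,0) and smooth ([hline_T10]), how a real-linear map moves it
    ([cplx_ext_hline]), and what its underlying real plane is
    ([real_subbundle_hline]). So for the differential of G it is enough to check
    that it sends [siegel_X] to X and [siegel_Y] to Y.

    That both manifolds are Kahler ([siegel_is_kahler], [cone_is_kahler]) comes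
    down to polynomial identities, once the tensors are written in real
    coordinates and differentiated by rules. The fundamental form of the cone is
    the exterior derivative of (r^2 / 4) omega; that of the Siegel domain is
    closed because d(Re theta) = 0 and d(Im theta) = 2 dx /\ dy, where
    z2 = x + iy. *)

Set Implicit Arguments.
Unset Strict Implicit.
Unset Printing Implicit Defensive.

Import Order.TTheory GRing.Theory Num.Theory.
Import numFieldNormedType.Exports.

Local Open Scope classical_set_scope.
Local Open Scope ring_scope.

(** * Differentials given by formulas *)

Section Calculus.
Context {R : realType} {V : normedModType R}.

(** [L] need not be presented as a linear map: this lets the rules below build
    it as a formula, which is then simplified by [deriv_is_ext]. *)
Definition deriv_is {W : normedModType R} (f : V -> W) (p : V) (L : V -> W) :=
  differentiable f p /\ forall v, 'D_v f p = L v.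

Lemma deriv_is_ext {W : normedModType R} (f : V -> W) p L L' :
  deriv_is f p L -> L =1 L' -> deriv_is f p L'.
Proof. by move=> [df Df] e; split=> // v; rewrite Df. Qed.

Lemma deriv_cst {W : normedModType R} (c : W) p :
  deriv_is (fun _ => c) p (fun _ => 0).
Proof.
by split; [exact: differentiable_cst | move=> v; exact: derive_cst].
Qed.

Lemma deriv_id p : deriv_is id p id.
Proof. by split=> [//|v]; exact: derive_id. Qed.

Lemma deriv_add {W : normedModType R} (f g : V -> W) p Lf Lg :
  deriv_is f p Lf -> deriv_is g p Lg ->
  deriv_is (fun q => f q + g q) p (fun v => Lf v + Lg v).
Proof.
move=> [df Df] [dg Dg]; split; first exact: differentiableD.
by move=> v; rewrite -Df -Dg; apply: deriveD; exact: diff_derivable.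
Qed.

Lemma deriv_opp {W : normedModType R} (f : V -> W) p L :
  deriv_is f p L -> deriv_is (fun q => - f q) p (fun v => - L v).
Proof.
move=> [df Df]; split; first exact: differentiableN.
by move=> v; rewrite -Df; apply: deriveN; exact: diff_derivable.
Qed.

Lemma deriv_mul (f g : V -> R) p Lf Lg :
  deriv_is f p Lf -> deriv_is g p Lg ->
  deriv_is (fun q => f q * g q) p (fun v => f p * Lg v + g p * Lf v).
Proof.
move=> [df Df] [dg Dg]; split; first exact: differentiableM.
by move=> v; rewrite -Df -Dg; apply: deriveM; exact: diff_derivable.
Qed.

Lemma deriv_sqr (f : V -> R) p L :
  deriv_is f p L -> deriv_is (fun q => f q ^+ 2) p (fun v => 2 * f p * L v).
Proof.
by move=> df; apply: deriv_is_ext (deriv_mul df df) _ => v; rewrite -mulrA mulr_natl.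
Qed.

Lemma deriv_inv (f : V -> R) p L : f p != 0 ->
  deriv_is f p L -> deriv_is (fun q => (f q)^-1) p (fun v => - (f p)^-1 ^+ 2 * L v).
Proof.
move=> f0 [df Df]; split; first exact: differentiableV.
by move=> v; rewrite -Df exprVn; apply: deriveV => //; exact: diff_derivable.
Qed.

Lemma deriv_scalel {W : normedModType R} (f : V -> R) (w : W) p L :
  deriv_is f p L -> deriv_is (fun q => f q *: w) p (fun v => L v *: w).
Proof.
move=> [df Df]; split; first exact: differentiableZl.
move=> v; rewrite deriveE; last exact: differentiableZl.
by rewrite diffZl// -deriveE// Df.
Qed.

Lemma deriv_sqrt (f : V -> R) p L : 0 < f p ->
  deriv_is f p L ->
  deriv_is (fun q => Num.sqrt (f q)) p (fun v => (2 * Num.sqrt (f p))^-1 * L v).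
Proof.
move=> f0 [df Df].
have [ds Ds] := is_derive1_sqrt f0.
have dsq : differentiable (Num.sqrt : R -> R) (f p) by exact/derivable1_diffP.
have dc : differentiable (Num.sqrt \o f) p by exact: differentiable_comp.
split=> // v; rewrite [LHS]deriveE// diff_comp//= -(deriveE _ df) Df.
by rewrite deriv1E // derive1E Ds; exact: mulrC.
Qed.

Lemma deriv_entry n (f : V -> 'rV[R]_n) p L j : deriv_is f p L ->
  deriv_is (fun q => f q 0 j) p (fun v => L v 0 j).
Proof.
move=> [df Df]; split=> [|v].
  apply: (@differentiable_comp _ _ _ _ f (fun M : 'rV[R]_n => M 0 j : R)) => //.
  exact: differentiable_coord.
by rewrite -Df derive_mx ?mxE //; exact: diff_derivable.
Qed.

(** * Functions of class C^k on an open set *)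

Lemma differentiable_near0 {W : normedModType R} (h : V -> W) p :
  (\near p, h p = 0) -> differentiable h p.
Proof.
move=> h0; have hp : h p = 0 by exact: nbhs_singleton h0.
have e : h \o shift p = cst (h p) + (\0 : {linear V -> W}) +o_ 0 id.
  have hs : \forall y \near (0 : V), h (y + p) = 0.
    by move: h0; rewrite (near_shift 0) subr0.
  apply/eqaddoP => _/posnumP[e]; near=> y.
  rewrite /= !fctE /= hp addr0 subr0.
  by rewrite (near hs y) ?normr0 ?mulr_ge0.
have c0 : continuous (\0 : {linear V -> W}) by move=> ?; exact: cvg_cst.
by apply/diff_locallyP; rewrite (diff_unique c0 e).
Unshelve. all: by end_near. Qed.

(** [g = f + (g - f)], and [g - f] vanishes near [p], so has differential 0 there. *)
Lemma near_eq_differentiable {W : normedModType R} (f g : V -> W) p :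
  (\near p, f p = g p) -> differentiable f p -> differentiable g p.
Proof.
move=> fg df; rewrite (_ : g = f + (g - f)); last first.
  by apply/funext => q; rewrite !fctE /= addrCA subrr addr0.
apply: differentiableD => //; apply: differentiable_near0.
by near=> q; rewrite !fctE (near fg q) ?subrr.
Unshelve. all: by end_near. Qed.

(** The iterated derivatives are taken of the total function, so that changing it
    outside [U] changes them; they still agree on [U] because [U] is open. *)
Lemma Ck_on_ext {W : normedModType R} k (U : set V) (f g : V -> W) :
  open U -> (forall p, U p -> f p = g p) -> Ck_on k U f -> Ck_on k U g.
Proof.
move=> oU; elim: k f g => [|k IH] f g fg /=.
all: have nr p : U p -> \near p, f p = g p
  by move=> Up; near=> q; apply: fg; near: q; exact: open_nbhs_nbhs.
  move=> cf p Up; have := cf p Up; rewrite /prop_for /continuous_at fg //.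
  by apply: cvg_trans; apply: near_eq_cvg; exact: nr.
move=> [df Df]; split.
  move=> p Up; apply: near_eq_differentiable (nr _ Up) (df _ Up).
move=> v; apply: IH (Df v) => p Up; exact: near_eq_derive (nr _ Up).
Unshelve. all: by end_near. Qed.

(** The step of every induction on [k] below: by [Ck_on_ext], a formula for the
    derivatives on [U] can replace the derivatives themselves. *)
Lemma Ck_onS {W : normedModType R} k (U : set V) (f : V -> W) (L : V -> V -> W) :
  open U -> (forall p, U p -> deriv_is f p (L p)) ->
  (forall v, Ck_on k U (fun p => L p v)) -> Ck_on k.+1 U f.
Proof.
move=> oU fL CL; split=> [p /fL[]//|v].
by apply: Ck_on_ext (CL v) => // p /fL[_ ->].
Qed.

Lemma Ck_on_deriv {W : normedModType R} k (U : set V) (f : V -> W) p :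
  Ck_on k.+1 U f -> U p -> deriv_is f p (fun v => 'D_v f p).
Proof. by move=> [df _] Up; split; first exact: df. Qed.

Lemma Ck_onW {W : normedModType R} k (U : set V) (f : V -> W) :
  Ck_on k.+1 U f -> Ck_on k U f.
Proof.
elim: k f => [|k IH] f [df Df].
  by move=> p /df; exact: differentiable_continuous.
by split=> // v; exact: IH (Df v).
Qed.

Section Closure.
Context (U : set V) (oU : open U).

Lemma Ck_on_cst {W : normedModType R} k (c : W) : Ck_on k U (fun _ => c).
Proof.
elim: k c => [|k IH] c; first by move=> p _; exact: cvg_cst.
exact: Ck_onS oU (fun p _ => deriv_cst c p) (fun v => IH 0).
Qed.

Lemma Ck_on_id k : Ck_on k U id.
Proof.
case: k => [p _|k]; first exact: cvg_id.
exact: Ck_onS oU (fun p _ => deriv_id p) (fun v => Ck_on_cst k v).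
Qed.

Lemma Ck_on_add {W : normedModType R} k (f g : V -> W) :
  Ck_on k U f -> Ck_on k U g -> Ck_on k U (fun p => f p + g p).
Proof.
elim: k f g => [|k IH] f g cf cg.
  by move=> p Up; apply: continuousD; [exact: cf|exact: cg].
apply: (Ck_onS oU (fun p Up => deriv_add (Ck_on_deriv cf Up) (Ck_on_deriv cg Up))).
by move=> v; apply: IH; [exact: cf.2|exact: cg.2].
Qed.

Lemma Ck_on_opp {W : normedModType R} k (f : V -> W) :
  Ck_on k U f -> Ck_on k U (fun p => - f p).
Proof.
elim: k f => [|k IH] f cf; first by move=> p Up; apply: continuousN; exact: cf.
apply: (Ck_onS oU (fun p Up => deriv_opp (Ck_on_deriv cf Up))).
by move=> v; apply: IH; exact: cf.2.
Qed.

Lemma Ck_on_mul k (f g : V -> R) :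
  Ck_on k U f -> Ck_on k U g -> Ck_on k U (fun p => f p * g p).
Proof.
elim: k f g => [|k IH] f g cf cg.
  by move=> p Up; apply: continuousM; [exact: cf|exact: cg].
apply: (Ck_onS oU (fun p Up => deriv_mul (Ck_on_deriv cf Up) (Ck_on_deriv cg Up))).
move=> v; apply: Ck_on_add; apply: IH.
- exact: Ck_onW.
- exact: cg.2.
- exact: Ck_onW.
- exact: cf.2.
Qed.

Lemma Ck_on_sqr k (f : V -> R) : Ck_on k U f -> Ck_on k U (fun p => f p ^+ 2).
Proof. by move=> cf; exact: (Ck_on_mul cf cf). Qed.

(** The derivative of [1 / f] involves [1 / f] again, one order lower; the same
    happens for the square root below. *)
Lemma Ck_on_inv k (f : V -> R) : (forall p, U p -> f p != 0) ->
  Ck_on k U f -> Ck_on k U (fun p => (f p)^-1).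
Proof.
move=> f0; elim: k => [|k IH] cf.
  by move=> p Up; apply: continuousV; [exact: f0|exact: cf].
apply: (Ck_onS oU (fun p Up => deriv_inv (f0 p Up) (Ck_on_deriv cf Up))).
move=> v; apply: Ck_on_mul; last exact: cf.2.
by apply: Ck_on_opp; apply: Ck_on_mul; apply: IH; exact: Ck_onW.
Qed.

Lemma Ck_on_sqrt k (f : V -> R) : (forall p, U p -> 0 < f p) ->
  Ck_on k U f -> Ck_on k U (fun p => Num.sqrt (f p)).
Proof.
move=> f0; elim: k => [|k IH] cf.
  move=> p Up; apply: (@continuous_comp _ _ _ f Num.sqrt); first exact: cf.
  exact: sqrt_continuous.
apply: (Ck_onS oU (fun p Up => deriv_sqrt (f0 p Up) (Ck_on_deriv cf Up))).
move=> v; apply: Ck_on_mul; last exact: cf.2.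
apply: Ck_on_inv => [p Up|].
  by rewrite mulf_neq0// gt_eqF// sqrtr_gt0 f0.
by apply: Ck_on_mul; [exact: Ck_on_cst | apply: IH; exact: Ck_onW].
Qed.

Lemma Ck_on_scalel {W : normedModType R} k (f : V -> R) (w : W) :
  Ck_on k U f -> Ck_on k U (fun p => f p *: w).
Proof.
elim: k f => [|k IH] f cf.
  by move=> p Up; apply: continuousZr_tmp; exact: cf.
apply: (Ck_onS oU (fun p Up => deriv_scalel w (Ck_on_deriv cf Up))).
by move=> v; apply: IH; exact: cf.2.
Qed.

Lemma Ck_on_entry n k (f : V -> 'rV[R]_n) j :
  Ck_on k U f -> Ck_on k U (fun q => f q 0 j).
Proof.
elim: k f => [|k IH] f cf.
  move=> p Up; apply: (@continuous_comp _ _ _ f (fun M : 'rV[R]_n => M 0 j)).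
    exact: cf.
  exact: coord_continuous.
apply: (Ck_onS oU (fun p Up => deriv_entry j (Ck_on_deriv cf Up))).
by move=> v; apply: IH; exact: cf.2.
Qed.

End Closure.
End Calculus.

(** * Coordinates on R^4 *)

Section Coord4.
Context {K : nzRingType}.
Implicit Types (u v : 'rV[K]_4) (a b c d k : K).

Lemma crd0_vec4 a b c d : crd0 (vec4 a b c d) = a. Proof. by rewrite /crd0 mxE. Qed.
Lemma crd1_vec4 a b c d : crd1 (vec4 a b c d) = b. Proof. by rewrite /crd1 mxE. Qed.
Lemma crd2_vec4 a b c d : crd2 (vec4 a b c d) = c. Proof. by rewrite /crd2 mxE. Qed.
Lemma crd3_vec4 a b c d : crd3 (vec4 a b c d) = d. Proof. by rewrite /crd3 mxE. Qed.
Definition crd_vec4 := (crd0_vec4, crd1_vec4, crd2_vec4, crd3_vec4).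

Lemma vec4_eta v : v = vec4 (crd0 v) (crd1 v) (crd2 v) (crd3 v).
Proof.
by apply/rowP => -[[|[|[|[|//]]]] i]; rewrite mxE /=; congr (v _ _); exact: val_inj.
Qed.

Lemma add_vec4 a b c d a' b' c' d' : vec4 a b c d + vec4 a' b' c' d' =
  vec4 (a + a') (b + b') (c + c') (d + d').
Proof. by apply/rowP => -[[|[|[|[|//]]]] i]; rewrite !mxE. Qed.

Lemma opp_vec4 a b c d : - vec4 a b c d = vec4 (- a) (- b) (- c) (- d).
Proof. by apply/rowP => -[[|[|[|[|//]]]] i]; rewrite !mxE. Qed.

Lemma scale_vec4 k a b c d : k *: vec4 a b c d = vec4 (k * a) (k * b) (k * c) (k * d).
Proof. by apply/rowP => -[[|[|[|[|//]]]] i]; rewrite !mxE. Qed.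

Lemma vec4_0 : 0 = vec4 0 0 0 0 :> 'rV[K]_4.
Proof. by apply/rowP => -[[|[|[|[|//]]]] i]; rewrite !mxE. Qed.

Definition vec4E := (add_vec4, opp_vec4, scale_vec4).

Lemma crd0D u v : crd0 (u + v) = crd0 u + crd0 v. Proof. by rewrite /crd0 mxE. Qed.
Lemma crd1D u v : crd1 (u + v) = crd1 u + crd1 v. Proof. by rewrite /crd1 mxE. Qed.
Lemma crd2D u v : crd2 (u + v) = crd2 u + crd2 v. Proof. by rewrite /crd2 mxE. Qed.
Lemma crd3D u v : crd3 (u + v) = crd3 u + crd3 v. Proof. by rewrite /crd3 mxE. Qed.
Lemma crd0Z k v : crd0 (k *: v) = k * crd0 v. Proof. by rewrite /crd0 mxE. Qed.
Lemma crd1Z k v : crd1 (k *: v) = k * crd1 v. Proof. by rewrite /crd1 mxE. Qed.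
Lemma crd2Z k v : crd2 (k *: v) = k * crd2 v. Proof. by rewrite /crd2 mxE. Qed.
Lemma crd3Z k v : crd3 (k *: v) = k * crd3 v. Proof. by rewrite /crd3 mxE. Qed.
Definition crd_lin := (crd0D, crd1D, crd2D, crd3D, crd0Z, crd1Z, crd2Z, crd3Z).

End Coord4.

Section CalculusR4.
Context {R : realType}.
Local Notation E := 'rV[R]_4.

Lemma deriv_crd0 (p : E) : deriv_is crd0 p crd0.
Proof. exact: deriv_entry (deriv_id p). Qed.
Lemma deriv_crd1 (p : E) : deriv_is crd1 p crd1.
Proof. exact: deriv_entry (deriv_id p). Qed.
Lemma deriv_crd2 (p : E) : deriv_is crd2 p crd2.
Proof. exact: deriv_entry (deriv_id p). Qed.
Lemma deriv_crd3 (p : E) : deriv_is crd3 p crd3.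
Proof. exact: deriv_entry (deriv_id p). Qed.

Lemma vec4_basis (a b c d : R) : vec4 a b c d =
  a *: vec4 1 0 0 0 + b *: vec4 0 1 0 0 + c *: vec4 0 0 1 0 + d *: vec4 0 0 0 1.
Proof. by rewrite !vec4E; congr vec4; ring. Qed.

Lemma deriv_vec4 (a b c d : E -> R) p La Lb Lc Ld :
  deriv_is a p La -> deriv_is b p Lb -> deriv_is c p Lc -> deriv_is d p Ld ->
  deriv_is (fun q => vec4 (a q) (b q) (c q) (d q)) p
    (fun v => vec4 (La v) (Lb v) (Lc v) (Ld v)).
Proof.
move=> ha hb hc hd.
rewrite (_ : (fun q => _) = fun q => a q *: vec4 1 0 0 0 + b q *: vec4 0 1 0 0
  + c q *: vec4 0 0 1 0 + d q *: vec4 0 0 0 1); last first.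
  by apply/funext => q; exact: vec4_basis.
apply: deriv_is_ext => [|v]; last by rewrite vec4_basis.
by do 3?[apply: deriv_add]; exact: deriv_scalel.
Qed.

Section Closure4.
Context (k : nat) (U : set E) (oU : open U).

Lemma Ck_on_crd0 : Ck_on k U crd0.
Proof. exact: Ck_on_entry (Ck_on_id oU k). Qed.
Lemma Ck_on_crd1 : Ck_on k U crd1.
Proof. exact: Ck_on_entry (Ck_on_id oU k). Qed.
Lemma Ck_on_crd2 : Ck_on k U crd2.
Proof. exact: Ck_on_entry (Ck_on_id oU k). Qed.
Lemma Ck_on_crd3 : Ck_on k U crd3.
Proof. exact: Ck_on_entry (Ck_on_id oU k). Qed.

Lemma Ck_on_vec4 (a b c d : E -> R) :
  Ck_on k U a -> Ck_on k U b -> Ck_on k U c -> Ck_on k U d ->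
  Ck_on k U (fun q => vec4 (a q) (b q) (c q) (d q)).
Proof.
move=> ha hb hc hd.
rewrite (_ : (fun q => _) = fun q => a q *: vec4 1 0 0 0 + b q *: vec4 0 1 0 0
  + c q *: vec4 0 0 1 0 + d q *: vec4 0 0 0 1); last first.
  by apply/funext => q; exact: vec4_basis.
by do 3?[apply: (Ck_on_add oU)]; exact: (Ck_on_scalel oU).
Qed.

End Closure4.

End CalculusR4.

(** The functions are passed to the rules explicitly, since unification does not
    recover the normed module [W] from a sum of real-valued functions. Constants
    are tried before the algebraic rules, so that a constant factor such as the
    inverse of a number leaves no side condition. *)
Ltac differentiate :=
  repeat match goal with
    | |- @deriv_is ?R ?V ?W _ ?p _ =>
        first [ apply (@deriv_cst R V W _ p) | apply deriv_crd0 | apply deriv_crd1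
              | apply deriv_crd2 | apply deriv_crd3 ]
    | |- @deriv_is ?R ?V ?W (fun q => @GRing.add _ (@?a q) (@?b q)) ?p _ =>
        eapply (@deriv_add R V W a b p)
    | |- @deriv_is ?R ?V ?W (fun q => @GRing.opp _ (@?a q)) ?p _ =>
        eapply (@deriv_opp R V W a p)
    | |- @deriv_is ?R ?V ?W (fun q => @GRing.mul _ (@?a q) (@?b q)) ?p _ =>
        eapply (@deriv_mul R V a b p)
    | |- @deriv_is ?R ?V ?W (fun q => @GRing.exp _ (@?a q) _) ?p _ =>
        eapply (@deriv_sqr R V a p)
    | |- @deriv_is ?R ?V ?W (fun q => @GRing.inv _ (@?a q)) ?p _ =>
        eapply (@deriv_inv R V a p)
    | |- @deriv_is ?R ?V ?W (fun q => Num.sqrt (@?a q)) ?p _ =>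
        eapply (@deriv_sqrt R V a p)
    | |- @deriv_is ?R ?V ?W (fun q => vec4 (@?a q) (@?b q) (@?c q) (@?d q)) ?p _ =>
        eapply (@deriv_vec4 R a b c d p)
    end.

Ltac smooth oU :=
  repeat match goal with
    | |- @Ck_on ?R ?V ?W ?k ?U _ =>
        first [ apply (@Ck_on_cst R V U oU W k _)
              | apply (Ck_on_crd0 k oU) | apply (Ck_on_crd1 k oU)
              | apply (Ck_on_crd2 k oU) | apply (Ck_on_crd3 k oU) ]
    | |- @Ck_on ?R ?V ?W ?k ?U (fun q => @GRing.add _ (@?a q) (@?b q)) =>
        apply (@Ck_on_add R V U oU W k a b)
    | |- @Ck_on ?R ?V ?W ?k ?U (fun q => @GRing.opp _ (@?a q)) =>
        apply (@Ck_on_opp R V U oU W k a)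
    | |- @Ck_on ?R ?V ?W ?k ?U (fun q => @GRing.mul _ (@?a q) (@?b q)) =>
        apply (@Ck_on_mul R V U oU k a b)
    | |- @Ck_on ?R ?V ?W ?k ?U (fun q => @GRing.exp _ (@?a q) _) =>
        apply (@Ck_on_sqr R V U oU k a)
    | |- @Ck_on ?R ?V ?W ?k ?U (fun q => @GRing.inv _ (@?a q)) =>
        apply (@Ck_on_inv R V U oU k a)
    | |- @Ck_on ?R ?V ?W ?k ?U (fun q => Num.sqrt (@?a q)) =>
        apply (@Ck_on_sqrt R V U oU k a)
    | |- @Ck_on ?R ?V ?W ?k ?U (fun q => vec4 (@?a q) (@?b q) (@?c q) (@?d q)) =>
        apply (@Ck_on_vec4 R k U oU a b c d)
    end.

(** * The Siegel domain is Kahler *)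

Section SiegelKahler.
Context {R : realType}.
Local Notation E := 'rV[R]_4.
Local Notation D := [set p : E | 0 < siegel_rho p].
Implicit Types p u v w : E.

(** The real and imaginary parts of the form dz1 + conj(z2) dz2. *)
Definition siegel_re p u : R := crd0 u + (crd2 p * crd2 u + crd3 p * crd3 u).
Definition siegel_im p u : R := crd1 u + (crd2 p * crd3 u - crd3 p * crd2 u).

Lemma siegel_rhoE p : siegel_rho p = - (2 * crd0 p) - (crd2 p ^+ 2 + crd3 p ^+ 2).
Proof. by rewrite /siegel_rho /= sqr_sqrtr // addr_ge0 ?sqr_ge0. Qed.

Lemma siegel_JE p u : siegel_J p u = vec4 (- crd1 u) (crd0 u) (- crd3 u) (crd2 u).
Proof. by rewrite /siegel_J /of_C2 /=; congr vec4; ring. Qed.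

Lemma bergmanE p u v : bergman_metric p u v =
  4 / siegel_rho p * (crd2 u * crd2 v + crd3 u * crd3 v) +
  4 / siegel_rho p ^+ 2 * (siegel_re p u * siegel_re p v + siegel_im p u * siegel_im p v).
Proof.
by rewrite /bergman_metric /polar_normc /siegel_re /siegel_im /=; congr (_ * _ + _ * _); ring.
Qed.

(** [Re theta = - d rho / 2] for [theta = dz1 + conj(z2) dz2]. *)
Lemma deriv_siegel_rho p : deriv_is siegel_rho p (fun v => - (2 * siegel_re p v)).
Proof.
rewrite (funext siegel_rhoE); eapply deriv_is_ext; first differentiate.
by move=> v; rewrite /= /siegel_re; ring.
Qed.

Lemma siegel_open : open D.
Proof.
apply: (@open_comp _ _ siegel_rho [set x : R | 0 < x]); last exact: open_gt.
by move=> p _; apply: differentiable_continuous; case: (deriv_siegel_rho p).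
Qed.

Lemma Ck_on_siegel_rho k (U : set E) : open U -> Ck_on k U siegel_rho.
Proof. by move=> oU; rewrite (funext siegel_rhoE); smooth oU. Qed.

Lemma bergman_smooth u v : smooth_on D (fun p => bergman_metric p u v).
Proof.
move=> k; rewrite (funext (fun p => bergmanE p u v)) /siegel_re /siegel_im.
smooth siegel_open; try exact/Ck_on_siegel_rho/siegel_open.
- by move=> p /= /lt0r_neq0.
- by move=> p /= /lt0r_neq0 ?; rewrite sqrf_eq0.
Qed.

Lemma deriv_siegel_re p u :
  deriv_is (siegel_re ^~ u) p (fun w => crd2 w * crd2 u + crd3 w * crd3 u).
Proof.
eapply deriv_is_ext; first by rewrite /siegel_re; differentiate.
by move=> w /=; ring.
Qed.

Lemma deriv_siegel_im p u :
  deriv_is (siegel_im ^~ u) p (fun w => crd2 w * crd3 u - crd3 w * crd2 u).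
Proof.
eapply deriv_is_ext; first by rewrite /siegel_im; differentiate.
by move=> w /=; ring.
Qed.

(** The terms with [siegel_re p w] come from [d (1 / rho) = 2 Re theta / rho^2]. *)
Lemma derive_bergman p u v w : 0 < siegel_rho p ->
  'D_w (fun q => bergman_metric q u v) p =
  8 / siegel_rho p ^+ 2 * siegel_re p w * (crd2 u * crd2 v + crd3 u * crd3 v)
  + 16 / siegel_rho p ^+ 3 * siegel_re p w *
      (siegel_re p u * siegel_re p v + siegel_im p u * siegel_im p v)
  + 4 / siegel_rho p ^+ 2 *
      ((crd2 w * crd2 u + crd3 w * crd3 u) * siegel_re p v
       + (crd2 w * crd2 v + crd3 w * crd3 v) * siegel_re p u
       + (crd2 w * crd3 u - crd3 w * crd2 u) * siegel_im p v
       + (crd2 w * crd3 v - crd3 w * crd2 v) * siegel_im p u).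
Proof.
move=> /lt0r_neq0 r0; move: w; apply: proj2 (_ : deriv_is _ _ _).
rewrite (funext (fun p => bergmanE p u v)).
eapply deriv_is_ext; first differentiate; try exact: deriv_siegel_rho;
  try exact: deriv_siegel_re; try exact: deriv_siegel_im.
- by [].
- by rewrite sqrf_eq0.
by move=> w /=; field.
Qed.

Lemma nijenhuis_const n (J : 'rV[R]_n -> 'rV[R]_n -> 'rV[R]_n) (p u v : 'rV[R]_n) :
  (forall q (w : 'rV[R]_n), J q w = J p w) -> J p 0 = 0 -> nijenhuis J p u v = 0.
Proof.
move=> cJ J0; have cJE (w : 'rV[R]_n) : J ^~ w = cst (J p w) by apply/funext => q; exact: cJ.
by rewrite /nijenhuis /lie_bracket !cJE !derive_cst !subrr !J0 !subr0.
Qed.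

Lemma bergman_gt0 p v : 0 < siegel_rho p -> v != 0 -> 0 < bergman_metric p v v.
Proof.
move=> r0 v0; rewrite bergmanE -!expr2.
set a := crd2 v; set b := crd3 v; set c := siegel_re p v; set d := siegel_im p v.
have ab : 0 <= a ^+ 2 + b ^+ 2 by rewrite addr_ge0 ?sqr_ge0.
have cd : 0 <= c ^+ 2 + d ^+ 2 by rewrite addr_ge0 ?sqr_ge0.
have k1 : 0 < 4 / siegel_rho p by rewrite divr_gt0.
have k2 : 0 < 4 / siegel_rho p ^+ 2 by rewrite divr_gt0 ?exprn_gt0.
move: (4 / siegel_rho p) (4 / siegel_rho p ^+ 2) k1 k2 => k k' k1 k2.
rewrite lt0r (addr_ge0 (mulr_ge0 (ltW k1) ab) (mulr_ge0 (ltW k2) cd)) andbT.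
apply: contra_neq v0 => /eqP.
rewrite paddr_eq0 ?mulr_ge0 ?(ltW k1) ?(ltW k2) //.
rewrite !mulf_eq0 ?(gt_eqF k1) ?(gt_eqF k2) /= !paddr_eq0 ?sqr_ge0 // !sqrf_eq0.
move=> /andP[/andP[/eqP a0 /eqP b0] /andP[/eqP c0 /eqP d0]].
move: c0 d0; rewrite /c /d /siegel_re /siegel_im -/a -/b a0 b0 !mulr0 subr0 !addr0.
by move=> c0 d0; rewrite (vec4_eta v) -/a -/b a0 b0 c0 d0 -vec4_0.
Qed.

Lemma siegel_is_kahler : is_kahler (@siegel_domain R).
Proof.
split => /=.
- exact: siegel_open.
- split.
  + move=> v k; rewrite (funext (fun p => siegel_JE p v)).
    by apply: Ck_on_cst; exact: siegel_open.
  + move=> p _ k u v; rewrite !siegel_JE !crd_lin !vec4E; congr vec4; ring.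
  + by move=> p v _; rewrite !siegel_JE !crd_vec4 [in RHS](vec4_eta v) vec4E.
  + move=> p u v _; apply: nijenhuis_const => [q w|]; first by rewrite !siegel_JE.
    by rewrite siegel_JE [0 in LHS]vec4_0 !crd_vec4 oppr0 -vec4_0.
- split.
  + exact: bergman_smooth.
  + move=> p u _ k v w; rewrite !bergmanE /siegel_re /siegel_im !crd_lin; ring.
  + move=> p u v _; rewrite !bergmanE; ring.
  + exact: bergman_gt0.
- move=> p u v _; rewrite !siegel_JE !bergmanE /siegel_re /siegel_im !crd_vec4; ring.
- split=> // p u v w r0.
  (* [siegel_J q] does not depend on [q]: its base point can be fixed at [p]. *)
  change (ext_d2 (fun q a b => bergman_metric q (siegel_J p a) b) p u v w = 0).
  rewrite /ext_d2 !derive_bergman //.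
  have := lt0r_neq0 r0; move: (siegel_rho p) => r r1.
  rewrite !siegel_JE /siegel_re /siegel_im !crd_vec4.
  move: (crd0 u) (crd1 u) (crd2 u) (crd3 u) (crd0 v) (crd1 v) (crd2 v) (crd3 v)
   (crd0 w) (crd1 w) (crd2 w) (crd3 w) (crd2 p) (crd3 p) => u0 u1 u2 u3 v0 v1 v2 v3
  w0 w1 w2 w3 x y.
  by field.
Qed.

End SiegelKahler.

(** * The cone over the Heisenberg group is Kahler *)

Section ConeKahler.
Context {R : realType}.
Local Notation E := 'rV[R]_4.
Local Notation D := [set p : E | 0 < crd3 p].
Implicit Types p u v w : E.

Lemma cone_open : open D.
Proof.
apply: (@open_comp _ _ (crd3 : E -> R) [set x : R | 0 < x]); last exact: open_gt.
by move=> p _; exact: coord_continuous.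
Qed.

Lemma cone_JE p v : cone_J p v =
  vec4 (- crd1 v) (crd0 v)
    (2 * crd3 v / crd3 p - 2 * crd0 p * crd0 v - 2 * crd1 p * crd1 v)
    (- (2^-1 * heis_omega p v * crd3 p)).
Proof.
rewrite /cone_J /heis_X /heis_Y /heis_Ttilde /cone_rdr /heis_omegatilde.
by rewrite !vec4E; congr vec4; ring.
Qed.

Lemma derive_cone_J p v w : 0 < crd3 p ->
  'D_w (cone_J ^~ v) p =
  vec4 0 0
    (- (2 * crd3 v * crd3 w / crd3 p ^+ 2) - 2 * crd0 w * crd0 v - 2 * crd1 w * crd1 v)
    (- ((crd0 w * crd1 v - crd1 w * crd0 v) * crd3 p + 2^-1 * heis_omega p v * crd3 w)).
Proof.
move=> /lt0r_neq0 r0; move: w; rewrite (funext (fun p => cone_JE p v)) /heis_omega.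
apply: proj2 (_ : deriv_is _ _ _).
eapply deriv_is_ext; first differentiate => //.
by move=> w /=; congr vec4; field.
Qed.

Lemma cone_J_smooth v : smooth_on D (cone_J ^~ v).
Proof.
move=> k; rewrite (funext (fun p => cone_JE p v)) /heis_omega.
by smooth cone_open => p /= /lt0r_neq0.
Qed.

Lemma cone_metric_smooth u v : smooth_on D (fun p => cone_metric p u v).
Proof.
move=> k; rewrite /cone_metric /heis_metric /heis_omega.
smooth cone_open.
Qed.

Lemma cone_formE p u v : cone_form p u v =
  2^-1 * crd3 p * (crd3 u * heis_omega p v - crd3 v * heis_omega p u)
  + crd3 p ^+ 2 * (crd0 u * crd1 v - crd1 u * crd0 v).
Proof.
have D2 (a : E) w : 'D_w (fun q => crd3 q ^+ 2 / 2 * heis_omegatilde q a) p =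
    2^-1 * crd3 p * crd3 w * heis_omega p a
    + 2^-1 * crd3 p ^+ 2 * (crd0 w * crd1 a - crd1 w * crd0 a).
  move: w; apply: proj2 (_ : deriv_is _ _ _).
  rewrite /heis_omegatilde /heis_omega; eapply deriv_is_ext; first differentiate.
  by move=> w /=; field.
by rewrite /cone_form /ext_d1 !D2; field.
Qed.

Lemma cone_metric_gt0 p v : 0 < crd3 p -> v != 0 -> 0 < cone_metric p v v.
Proof.
move=> r0 v0; rewrite /cone_metric /heis_metric -!expr2.
set a := crd3 v; set b := crd0 v; set c := crd1 v; set d := heis_omega p v.
have k1 : 0 < crd3 p ^+ 2 by rewrite exprn_gt0.
have dd : 0 <= 4^-1 * d ^+ 2 by rewrite mulr_ge0 ?sqr_ge0.
have bc : 0 <= b ^+ 2 + c ^+ 2 by rewrite addr_ge0 ?sqr_ge0.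
rewrite lt0r (addr_ge0 (sqr_ge0 a) (mulr_ge0 (ltW k1) (addr_ge0 bc dd))) andbT.
apply: contra_neq v0 => /eqP.
rewrite paddr_eq0 ?sqr_ge0 ?(mulr_ge0 (ltW k1) (addr_ge0 bc dd)) //.
rewrite (mulf_eq0 (crd3 p ^+ 2)) (gt_eqF k1) /= paddr_eq0 // paddr_eq0 ?sqr_ge0 //.
rewrite (mulf_eq0 4^-1) invr_eq0 (pnatr_eq0 R 4) /= !sqrf_eq0.
move=> /andP[/eqP a0 /andP[/andP[/eqP b0 /eqP c0] /eqP]].
rewrite /d /heis_omega -/b -/c b0 c0 !mulr0 subr0 addr0 => d0.
by rewrite (vec4_eta v) -/a -/b -/c a0 b0 c0 d0 -vec4_0.
Qed.

Lemma cone_is_kahler : is_kahler (@heis_cone R).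
Proof.
split => /=.
- exact: cone_open.
- split.
  + exact: cone_J_smooth.
  + by move=> p _ k u v; rewrite !cone_JE /heis_omega !crd_lin !vec4E; congr vec4; ring.
  + move=> p v /lt0r_neq0 r0; rewrite !cone_JE /heis_omega !crd_vec4.
    by rewrite [in RHS](vec4_eta v) vec4E; congr vec4; field.
  + move=> p u v r0; rewrite /nijenhuis /lie_bracket !derive_cst.
    rewrite !derive_cone_J // subrr sub0r !subr0 !cone_JE /heis_omega.
    rewrite !(vec4E, crd_vec4) [RHS]vec4_0.
    by have := lt0r_neq0 r0 => r1; congr vec4; field.
- split.
  + exact: cone_metric_smooth.
  + by move=> p u _ k v w; rewrite /cone_metric /heis_metric /heis_omega !crd_lin /=; ring.
  + by move=> p u v _; rewrite /cone_metric /heis_metric /heis_omega; ring.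
  + exact: cone_metric_gt0.
- move=> p u v /lt0r_neq0 r0; rewrite !cone_JE /cone_metric /heis_metric /heis_omega !crd_vec4.
  by field.
- split=> [p u v /lt0r_neq0 r0|p u v w _].
    rewrite cone_formE cone_JE /cone_metric /heis_metric /heis_omega !crd_vec4.
    by field.
  have D2 (a b c : E) : 'D_c (fun q => cone_form q a b) p =
      2^-1 * crd3 c * (crd3 a * heis_omega p b - crd3 b * heis_omega p a)
      + crd3 p * (crd3 a * (crd0 c * crd1 b - crd1 c * crd0 b) -
                  crd3 b * (crd0 c * crd1 a - crd1 c * crd0 a))
      + 2 * crd3 p * crd3 c * (crd0 a * crd1 b - crd1 a * crd0 b).
    move: c; apply: proj2 (_ : deriv_is _ _ _).
    rewrite (funext (fun q => cone_formE q a b)) /heis_omega.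
    eapply deriv_is_ext; first differentiate.
    by move=> c /=; field.
  by rewrite /ext_d2 !D2 /heis_omega; field.
Qed.

End ConeKahler.

(** * Complex lines spanned by a real frame *)

Section HolomorphicLine.
Context {R : realType} {n : nat}.
Local Notation E := 'rV[R]_n.
Local Notation EC := 'rV[R[i]]_n.

(** The vector field Z = (X - iY) / 2 is the case [u = X], [v = Y]. *)
Definition hframe (u v : E) : EC := 2^-1 *: (to_cplx u - 'i *: to_cplx v).
Definition hline (u v : E) : set EC := [set c *: hframe u v | c in [set: R[i]]].

Lemma hframeE u v j :
  hframe u v 0 j = ((2^-1 * u 0 j) +i* (- (2^-1 * v 0 j)))%C.
Proof.
rewrite !mxE (_ : 2^-1 = (2^-1)%:C%C :> R[i]); last by rewrite fmorphV rmorph_nat.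
by apply/eqP; rewrite eq_complex /=; apply/andP; split; apply/eqP; ring.
Qed.

(** Rotating the real frame by a quarter turn multiplies the complex one by i. *)
Lemma hframe_rot u v : hframe v (- u) = 'i *: hframe u v.
Proof.
rewrite /hframe scalerA mulrC -scalerA; congr (_ *: _).
rewrite scalerBr scalerA -[in RHS]expr2 sqrCi scaleN1r opprK addrC.
by rewrite /to_cplx map_mxN scalerN opprK.
Qed.

Lemma re_hline c u v :
  re_part (c *: hframe u v) = (2^-1 * complex.Re c) *: u + (2^-1 * complex.Im c) *: v.
Proof. by apply/rowP => j; rewrite mxE mxE hframeE !mxE; case: c => a b /=; ring. Qed.

Lemma im_hline c u v :
  im_part (c *: hframe u v) = (2^-1 * complex.Im c) *: u - (2^-1 * complex.Re c) *: v.
Proof. by apply/rowP => j; rewrite mxE mxE hframeE !mxE; case: c => a b /=; ring. Qed.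

(** The complexification of a real-linear map is complex-linear. *)
Lemma cplx_ext_hframe (f : E -> E) c u v : linear f ->
  cplx_ext f (c *: hframe u v) = c *: hframe (f u) (f v).
Proof.
move=> flin.
have fD a b : f (a *: u + b *: v) = a *: f u + b *: f v.
  have f0 : f 0 = 0.
    by have := flin (- 1) 0 0; rewrite scaler0 addr0 scaleN1r addNr.
  by rewrite flin -[in LHS](addr0 (b *: v)) flin f0 addr0.
rewrite /cplx_ext re_hline im_hline -scaleNr !fD.
apply/rowP => j; rewrite [RHS]mxE hframeE !mxE; case: c => a b /=.
by apply/eqP; rewrite eq_complex /=; apply/andP; split; apply/eqP; ring.
Qed.

Lemma cplx_ext_hline (f : E -> E) u v : linear f ->
  cplx_ext f @` hline u v = hline (f u) (f v).
Proof.
move=> flin; apply/seteqP; split=> w /=.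
  by move=> [_ [c _ <-] <-]; exists c => //; rewrite cplx_ext_hframe.
by move=> [c _ <-]; exists (c *: hframe u v); [exists c|exact: cplx_ext_hframe].
Qed.

Lemma real_subbundle_hline (u v : E -> E) p w :
  real_subbundle (fun q => hline (u q) (v q)) p w ->
  exists a b : R, w = a *: u p + b *: v p.
Proof. by move=> [_ [c _ <-] <-]; do 2 eexists; exact: re_hline. Qed.

(** If [J u = v] and [J v = - u] then [J] rotates the frame, so by [hframe_rot] it acts
    on [hframe u v] as multiplication by i. Its real part is [u / 2], so [hframe u v]
    vanishes nowhere and frames the line globally on the carrier. *)
Lemma hline_T10 (N : kahler_data R n) (u v : E -> E) :
  open (carrier N) ->
  (forall p, carrier N p -> linear (cplx N p)) ->
  smooth_on (carrier N) u -> smooth_on (carrier N) v ->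
  (forall p, carrier N p -> u p != 0) ->
  (forall p, carrier N p -> cplx N p (u p) = v p) ->
  (forall p, carrier N p -> cplx N p (v p) = - u p) ->
  T10_subbundle N (fun p => hline (u p) (v p)).
Proof.
move=> oN Jlin su sv u0 Ju Jv; split=> [p Np _ [c _ <-]|].
  rewrite /T10 /= cplx_ext_hframe; last exact: Jlin.
  by rewrite (Ju p Np) (Jv p Np) hframe_rot !scalerA [c * _]mulrC.
exists 1%N => p Np; exists (carrier N), (fun q => hframe (u q) (v q)); split=> //.
- move=> i j; rewrite (ord1 i); split=> k.
    rewrite (funext (fun q => congr1 (@complex.Re R) (hframeE (u q) (v q) j))) /=.
    by apply: Ck_on_mul => //; [exact: Ck_on_cst|apply: Ck_on_entry].
  rewrite (funext (fun q => congr1 (@complex.Im R) (hframeE (u q) (v q) j))) /=.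
  apply: Ck_on_opp => //.
  by apply: Ck_on_mul => //; [exact: Ck_on_cst|apply: Ck_on_entry].
- move=> q Nq; split.
    have : hframe (u q) (v q) != 0.
      apply: contra_neq (u0 q Nq) => /rowP h; apply/rowP => j.
      have := h j; rewrite hframeE mxE => /(congr1 (@complex.Re R)) /= /eqP.
      by rewrite mulf_eq0 invr_eq0 (pnatr_eq0 R 2) mxE => /eqP.
    by rewrite /row_free rank_rV => ->.
  apply/seteqP; split=> w /=.
    by move=> [c _ <-]; rewrite scalemx_sub.
  by move=> /sub_rVP[c ->]; exists c.
Qed.

End HolomorphicLine.

(** * The equivalence *)

Section Equivalence.
Context {R : realType}.
Local Notation E := 'rV[R]_4.
Local Notation S := [set p : E | 0 < siegel_rho p].
Local Notation C := [set p : E | 0 < crd3 p].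
Implicit Types p q u v w : E.

(** Twice the real part, and minus twice the imaginary part, of the generator
    - conj(z2) d/dz1 + d/dz2. *)
Definition siegel_X p : E := vec4 (- crd2 p) (crd3 p) 1 0.
Definition siegel_Y p : E := vec4 (- crd3 p) (- crd2 p) 0 1.

Lemma siegel_subbundleE : @siegel_subbundle R = fun p => hline (siegel_X p) (siegel_Y p).
Proof.
apply/funext => p; rewrite /siegel_subbundle /hline.
suff -> : - (z2 p)^* *: ddz1 + ddz2 = hframe (siegel_X p) (siegel_Y p) by [].
apply/rowP => j; rewrite hframeE.
have h2 : 2^-1 = (2^-1)%:C%C :> R[i] by rewrite fmorphV rmorph_nat.
rewrite /ddz1 /ddz2 scale_vec4 add_vec4 h2 /siegel_X /siegel_Y /z2.
by case: j => -[|[|[|[|//]]]] ?; rewrite !mxE /=; apply/eqP; rewrite eq_complex /=;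
  apply/andP; split; apply/eqP; ring.
Qed.

Lemma cone_subbundleE : @cone_subbundle R = fun p => hline (heis_X p) (heis_Y p).
Proof. by []. Qed.

Lemma siegel_subbundle_T10 : T10_subbundle (@siegel_domain R) (@siegel_subbundle R).
Proof.
rewrite siegel_subbundleE; apply: hline_T10.
- exact: siegel_open.
- by move=> p _ k u v; rewrite /= !siegel_JE !crd_lin !vec4E; congr vec4; ring.
- by move=> k; rewrite /siegel_X; smooth (@siegel_open R).
- by move=> k; rewrite /siegel_Y; smooth (@siegel_open R).
- move=> p _; apply/eqP => /(congr1 crd2); rewrite crd_vec4 vec4_0 crd_vec4.
  by apply/eqP; exact: oner_neq0.
- by move=> p _; rewrite /= siegel_JE !crd_vec4 oppr0.
- by move=> p _; rewrite /= siegel_JE !crd_vec4 !vec4E oppr0.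
Qed.

Lemma cone_subbundle_T10 : T10_subbundle (@heis_cone R) (@cone_subbundle R).
Proof.
rewrite cone_subbundleE; apply: hline_T10.
- exact: cone_open.
- by have [_ [_ + _ _]] := @cone_is_kahler R.
- by move=> k; rewrite /heis_X; smooth (@cone_open R).
- by move=> k; rewrite /heis_Y; smooth (@cone_open R).
- move=> p _; apply/eqP => /(congr1 crd0); rewrite crd_vec4 vec4_0 crd_vec4.
  by apply/eqP; exact: oner_neq0.
- by move=> p _; rewrite /= cone_JE /heis_omega !crd_vec4; congr vec4; ring.
- by move=> p _; rewrite /= cone_JE /heis_omega !crd_vec4 !vec4E; congr vec4; ring.
Qed.

Definition to_cone p : E :=
  vec4 (crd2 p) (crd3 p) (2 * crd1 p) (2 / Num.sqrt (siegel_rho p)).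

(** The first entry is [Re z1], from [rho = - 2 Re z1 - |z2|^2 = 4 / r^2]. *)
Definition of_cone q : E :=
  vec4 (- (4 / crd3 q ^+ 2 + crd0 q ^+ 2 + crd1 q ^+ 2) / 2) (crd2 q / 2) (crd0 q) (crd1 q).

Lemma siegel_rho_of_cone q : siegel_rho (of_cone q) = 4 / crd3 q ^+ 2.
Proof. by rewrite siegel_rhoE !crd_vec4; move: (4 / _) => s; field. Qed.

Lemma to_cone_diffeo : diffeomorphism S C to_cone.
Proof.
split; [|split].
- move=> k; rewrite /to_cone.
  by smooth (@siegel_open R); try exact/Ck_on_siegel_rho/siegel_open => //;
   move=> p /= r0; rewrite ?gt_eqF ?sqrtr_gt0.
- by move=> p /= r0; rewrite crd_vec4 divr_gt0 // sqrtr_gt0.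
exists of_cone; split.
- move=> k; rewrite /of_cone; smooth (@cone_open R) => p /= r0.
  by rewrite gt_eqF ?exprn_gt0.
- by move=> q /= r0; rewrite siegel_rho_of_cone divr_gt0 ?exprn_gt0.
- move=> p /= r0; rewrite [RHS]vec4_eta /of_cone /to_cone !crd_vec4; congr vec4.
    rewrite expr_div_n sqr_sqrtr ?ltW // siegel_rhoE.
    have := lt0r_neq0 r0; rewrite siegel_rhoE => r1.
    by field.
  by field.
- move=> q /= r0; rewrite [RHS]vec4_eta /to_cone siegel_rho_of_cone !crd_vec4; congr vec4.
    by field.
  have r1 := lt0r_neq0 r0.
  rewrite (_ : 4 / crd3 q ^+ 2 = (2 / crd3 q) ^+ 2); last by field.
  by rewrite sqrtr_sqr ger0_norm ?divr_ge0 ?ltW//; field.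
Qed.

(** The last entry comes from [d rho = - 2 Re theta]; as [siegel_X] and [siegel_Y] are
    in the kernel of [theta], their images have no [d/dr] component. *)
Lemma deriv_to_cone p : 0 < siegel_rho p ->
  deriv_is to_cone p (fun v => vec4 (crd2 v) (crd3 v) (2 * crd1 v)
    (2 * siegel_re p v / Num.sqrt (siegel_rho p) ^+ 3)).
Proof.
move=> r0; have s0 : Num.sqrt (siegel_rho p) != 0 by rewrite gt_eqF ?sqrtr_gt0.
rewrite /to_cone; eapply deriv_is_ext.
  by differentiate => //; exact: deriv_siegel_rho.
by move=> v /=; congr vec4; field.
Qed.

Lemma diff_to_cone_X p : 0 < siegel_rho p -> 'd to_cone p (siegel_X p) = heis_X (to_cone p).
Proof.
move=> /deriv_to_cone[d D]; rewrite -deriveE // D /siegel_re /heis_X !crd_vec4.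
by congr vec4; ring.
Qed.

Lemma diff_to_cone_Y p : 0 < siegel_rho p -> 'd to_cone p (siegel_Y p) = heis_Y (to_cone p).
Proof.
move=> /deriv_to_cone[d D]; rewrite -deriveE // D /siegel_re /heis_Y !crd_vec4.
by congr vec4; ring.
Qed.

Lemma bergman_horizontal p a b c d :
  bergman_metric p (a *: siegel_X p + b *: siegel_Y p) (c *: siegel_X p + d *: siegel_Y p)
  = 4 / siegel_rho p * (a * c + b * d).
Proof.
by rewrite bergmanE /siegel_re /siegel_im !crd_lin !crd_vec4; ring.
Qed.

Lemma cone_horizontal q a b c d :
  cone_metric q (a *: heis_X q + b *: heis_Y q) (c *: heis_X q + d *: heis_Y q)
  = crd3 q ^+ 2 * (a * c + b * d).
Proof.
rewrite /cone_metric /heis_metric /heis_omega !crd_lin !crd_vec4.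
by field.
Qed.

End Equivalence.

Theorem corollary6p3 (R : realType) :
  PCR_kahler_equivalent (@siegel_domain R) (@heis_cone R)
    (@siegel_subbundle R) (@cone_subbundle R).
Proof.
split.
- exact: siegel_is_kahler.
- exact: cone_is_kahler.
- exact: siegel_subbundle_T10.
- exact: cone_subbundle_T10.
exists to_cone; split.
- exact: to_cone_diffeo.
- move=> p /= r0; rewrite siegel_subbundleE cone_subbundleE cplx_ext_hline; last exact: linearP.
  by rewrite diff_to_cone_X ?diff_to_cone_Y.
move=> p u v /= r0; rewrite siegel_subbundleE.
move=> /real_subbundle_hline[a [b ->]] /real_subbundle_hline[c [d ->]].
rewrite !linearD !linearZ /= diff_to_cone_X // diff_to_cone_Y //.
rewrite cone_horizontal bergman_horizontal crd_vec4 expr_div_n sqr_sqrtr ?ltW //.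
by congr (_ / _ * _); ring.
Qed.
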